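(* Let $S=(\mathsf{Top},\{S(i)\mid i\in I\})$ be a spatial family of hybrid automata (SFHA) and let $\Phi_{\mathsf{entry}}\to\Box\Phi_{\mathsf{safe}}$ be a safety property with GMR-exhaustive entry conditions. Then $S$ satisfies $\Phi_{\mathsf{entry}}\to\Box\Phi_{\mathsf{safe}}$ if and only if all of the following hold: (1) every state satisfying $\Phi_{\mathsf{entry}}$ satisfies $\Phi_{\mathsf{safe}}$; (2) $\Phi_{\mathsf{safe}}$ is preserved under all flows starting from a state satisfying $\Phi_{\mathsf{entry}}$; (3) $\Phi_{\mathsf{safe}}$ is preserved under all GMR jumps; (4) $\Phi_{\mathsf{safe}}$ is preserved under all GMR topology updates.
   Context: Setting (SFHA). Fix a countably infinite index set $I$ containing a distinguished element $\mathsf{nil}$, a finite set $X=\{x_1,\dots,x_n\}$ of real-valued variable names and a finite set $P=P_S\cup P_N$ of pointer symbols, each interpreted at any moment as a function $p:I\to I$. Formulae are written in a two-sorted first-order language with a sort index (constant $\mathsf{nil}$, unary function symbols in $P$, equality) and a sort num (interpreted in $\mathbb R$), with unary function symbols $x:\mathrm{index}\to\mathrm{num}$ for $x\in X$ and $x_p$ for $x\in X,p\in P$. For each $i\in I$ the component $S(i)$ is a hybrid automaton with a common finite set of modes $Q$ and common finite multiset of control switches $E\subseteq Q\times Q$, real-valued variables $x(i)$ and $x_p(i)$ ($x\in X,p\in P$), and, for $q\in Q,e\in E$, predicates $\mathsf{Init}_q(i),\mathsf{Inv}_q(i)$, $\mathsf{flow}_q(i)$ (over variables and derivatives), $\mathsf{guard}_e(i)$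 and $\mathsf{jump}_e(i)$ (over variables and primed post-jump copies), identical for all $i$ up to the index. The topology automaton $\mathsf{Top}$ has one mode, an initial condition $\mathsf{Init}_{\mathsf{Top}}$ and an invariant, and its transitions (topology updates) change the pointers $p\in P$ (and possibly the $x_p(i)$) according to update rules $\mathsf{Update}(p,p')$, never changing any $x(i)$. An SFHA is $S=(\mathsf{Top},\{S(i)\mid i\in I\})$. States and runs. A state is $(q,a)$ with $q\in Q^I$ and $a$ a valuation of all variables and pointers; admissible if $a$ satisfies the invariant of $\mathsf{Top}$ and each restriction to $S(i)$ satisfies $\mathsf{Inv}_{q_i}(i)$; initial if it is initial for $\mathsf{Top}$ and each restriction is initial for $S(i)$. A state change is a flow of length $t$ if its restriction to every $S(i)$ is a flow of length $t$ of $S(i)$; a jump if its restriction to every $S(i)$ is a jump of $S(i)$ or a flow of length $0$; a topology update if it is a transition of $\mathsf{Top}$. A run is a sequence $s_0,s_1,\dots$ of admissible states, $s_0$ initial, consecutive pairs being jumps, flows or topology updates, each flow followed by a jump or topology update. $S$ satisfies $\Phi_{\mathsf{entry}}\to\Box\Phi_{\mathsf{safe}}$ if in every run whose first state satisfies $\Phi_{\mathsf{entry}}$, $\Phi_{\mathsf{safe}}$ holds throughout. $\Phi_{\mathsf{safe}}$ is preserved under $(s,s')$ if whenever it holds in $s$ it holds in $s'$ (for flows: throughout the flow). Global mode reachability: a state $(q,a)$ is GMR if there is $(q,a_0)$ with $a_0$ satisfying $\Phi_{\mathsf{entry}}$ and a flow in $S$ from $(q,a_0)$ to $(q,a)$;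 a state change $(s,s')$ is GMR if $s$ is GMR. GMR-exhaustive entry conditions: $\Phi_{\mathsf{entry}}=\forall i_1\dots i_m\,\phi_{\mathsf{entry}}(\overline x(i_1),\dots,\overline x(i_m))$ is a formula of the language such that (i) every state satisfying $\Phi_{\mathsf{entry}}$ is initial for $S$, and (ii) for every GMR jump or GMR topology update $(s,s')$, $\Phi_{\mathsf{entry}}$ holds in $s'$. *)

(* Defs.v *)
From HB Require Import structures.
From mathcomp Require Import all_boot all_order all_algebra.
From mathcomp Require Import all_classical all_reals all_analysis.

Set Implicit Arguments.
Unset Strict Implicit.
Unset Printing Implicit Defensive.

Import Order.TTheory GRing.Theory Num.Theory.
Import numFieldNormedType.Exports.
Local Open Scope classical_set_scope.
Local Open Scope ring_scope.

(* Two-sorted first-order language over pointer symbols P and numeric function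
   symbols V : index -> num.  Variables of each sort are well-scoped de Bruijn
   indices: [formula R P V n k] has n free index variables and k free numeric
   variables.  The sort num carries the ordered-ring signature with a constant
   for every real number. *)
Section Language.
Variables (R : realType) (P V : Type).

Inductive iterm (n : nat) : Type :=
| INil
| IVar of 'I_n
| IPtr of P & iterm n.

Inductive nterm (n k : nat) : Type :=
| NVar of 'I_k
| NConst of R
| NFun of V & iterm n
| NAdd of nterm n k & nterm n k
| NOpp of nterm n k
| NMul of nterm n k & nterm n k.

Inductive formula (n k : nat) : Type :=
| FEqI of iterm n & iterm n
| FEqN of nterm n k & nterm n k
| FLeN of nterm n k & nterm n k
| FNot of formula n k
| FAnd of formula n k & formula n k
| FOr of formula n k & formula n k
| FImp of formula n k & formula n k
| FAllI of formula n.+1 k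
| FExI of formula n.+1 k
| FAllN of formula n k.+1
| FExN of formula n k.+1.

Definition sentence := formula 0 0.

Fixpoint forall_index (m : nat) : formula m 0 -> sentence :=
  match m with
  | 0%N => fun phi => phi
  | m'.+1 => fun phi => forall_index (FAllI phi)
  end.

Record interp (I : Type) := Interp {
  ptr : P -> I -> I;
  num : V -> I -> R }.

Definition scons (T : Type) (n : nat) (x : T) (e : 'I_n -> T) : 'I_n.+1 -> T :=
  fun j => if unlift ord0 j is Some i then e i else x.

Section Semantics.
Variables (I : Type) (nil : I) (a : interp I).

Fixpoint eval_i n (e : 'I_n -> I) (t : iterm n) : I :=
  match t with
  | INil => nil
  | IVar j => e j
  | IPtr p u => ptr a p (eval_i e u)
  end.

Fixpoint eval_n n k (e : 'I_n -> I) (r : 'I_k -> R) (t : nterm n k) : R :=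
  match t with
  | NVar j => r j
  | NConst c => c
  | NFun x u => num a x (eval_i e u)
  | NAdd u v => eval_n e r u + eval_n e r v
  | NOpp u => - eval_n e r u
  | NMul u v => eval_n e r u * eval_n e r v
  end.

Fixpoint sat n k (e : 'I_n -> I) (r : 'I_k -> R) (phi : formula n k) : Prop :=
  match phi with
  | FEqI u v => eval_i e u = eval_i e v
  | FEqN u v => eval_n e r u = eval_n e r v
  | FLeN u v => eval_n e r u <= eval_n e r v
  | FNot f => ~ sat e r f
  | FAnd f g => sat e r f /\ sat e r g
  | FOr f g => sat e r f \/ sat e r g
  | FImp f g => sat e r f -> sat e r g
  | FAllI f => forall i, sat (scons i e) r f
  | FExI f => exists i, sat (scons i e) r f
  | FAllN f => forall c, sat e (scons c r) f
  | FExN f => exists c, sat e (scons c r) f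
  end.

Definition holds (phi : sentence) : Prop :=
  sat (fun _ : 'I_0 => nil) (fun _ : 'I_0 => 0) phi.

End Semantics.
End Language.

(* [ha_switch] with its two endpoint maps encodes a finite multiset of control
   switches over pairs of modes. *)
Record hybrid_automaton (R : realType) (V : finType) := HybridAutomaton {
  ha_mode : finType;
  ha_switch : finType;
  ha_src : ha_switch -> ha_mode;
  ha_tgt : ha_switch -> ha_mode;
  ha_init : ha_mode -> (V -> R) -> Prop;
  ha_inv : ha_mode -> (V -> R) -> Prop;
  (* values, then first derivatives *)
  ha_flow : ha_mode -> (V -> R) -> (V -> R) -> Prop;
  ha_guard : ha_switch -> (V -> R) -> Prop;
  (* values before, then after the jump *)
  ha_jump : ha_switch -> (V -> R) -> (V -> R) -> Prop }.

Section HybridAutomata.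
Variables (R : realType) (V : finType) (H : hybrid_automaton R V).
Implicit Types (q : ha_mode H) (b : V -> R).

(* As usual for hybrid automata, an initial state lies in the invariant. *)
Definition ha_initial q b : Prop := ha_init q b /\ ha_inv q b.

Definition ha_is_jump q b q' b' : Prop :=
  exists e : ha_switch H,
    [/\ ha_src e = q, ha_tgt e = q', ha_guard e b & ha_jump e b b'].

(* f is the trajectory of a flow of length t in mode q from b to b'; only its
   values on [0, t] matter. *)
Definition ha_is_flow (t : R) (f : R -> V -> R) q b q' b' : Prop :=
  [/\ 0 <= t, q' = q, f 0 = b /\ f t = b',
      forall v : V,
        {within `[(0 : R), t]%classic, continuous (fun u : R => f u v)} &
      (forall u : R, 0 <= u <= t -> ha_inv q (f u)) /\
      (forall u : R, 0 < u < t -> exists d : V -> R,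
         (forall v : V, is_derive u (1 : R) (fun w : R => f w v) (d v)) /\
         ha_flow q (f u) d)].

End HybridAutomata.

(* The real-valued variables of a component: x for x in X, and x_p for x in X
   and p in P. *)
Definition var (X P : finType) : finType := (X + X * P)%type.

(* An update rule is a sentence over doubled symbols: [inl] is the copy before
   the update and [inr] the primed copy after it. *)
Record topology_automaton (R : realType) (X P : finType) := TopologyAutomaton {
  top_init : sentence R P (var X P);
  top_inv : sentence R P (var X P);
  top_switch : finType;
  top_update : top_switch -> P -> sentence R (P + P) (var X P + var X P) }.

(* All components S(i) are copies of one automaton, differing only in the
   index attached to its variables. *)
Record sfha (R : realType) (X P : finType) := Sfha {
  sfha_top : topology_automaton R X P;
  sfha_comp : hybrid_automaton R (var X P) }.

Section SFHA.
Variables (R : realType) (I : Type) (nil : I) (X P : finType) (S : sfha R X P).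

Local Notation Top := (sfha_top S).
Local Notation valuation := (interp R P (var X P) I).

Definition state : Type := (I -> ha_mode (sfha_comp S)) * valuation.

Definition restr (a : valuation) (i : I) : var X P -> R := fun v => num a v i.

Definition admissible (s : state) : Prop :=
  holds nil s.2 (top_inv Top) /\
  forall i, ha_inv (s.1 i) (restr s.2 i).

Definition top_initial (a : valuation) : Prop :=
  holds nil a (top_init Top) /\ holds nil a (top_inv Top).

Definition initial (s : state) : Prop :=
  top_initial s.2 /\ forall i, ha_initial (s.1 i) (restr s.2 i).

(* The pointers belong to Top, which stays in its single mode during a flow:
   they are constant and the invariant of Top holds throughout. *)
Definition is_flow (t : R) (F : R -> valuation) (s s' : state) : Prop :=
  [/\ F 0 = s.2, F t = s'.2,
      forall i, ha_is_flow t (fun u => restr (F u) i)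
                  (s.1 i) (restr s.2 i) (s'.1 i) (restr s'.2 i) &
      forall u : R, 0 <= u <= t ->
        ptr (F u) = ptr s.2 /\ holds nil (F u) (top_inv Top)].

Definition is_jump (s s' : state) : Prop :=
  ptr s'.2 = ptr s.2 /\
  forall i,
    ha_is_jump (s.1 i) (restr s.2 i) (s'.1 i) (restr s'.2 i) \/
    exists f, ha_is_flow 0 f (s.1 i) (restr s.2 i) (s'.1 i) (restr s'.2 i).

Definition sum_fun (A B C : Type) (f : A -> C) (g : B -> C) (z : A + B) : C :=
  match z with inl x => f x | inr y => g y end.

Definition before_after (a a' : valuation) :
    interp R (P + P) (var X P + var X P) I :=
  Interp (sum_fun (ptr a) (ptr a')) (sum_fun (num a) (num a')).

Definition is_update (s s' : state) : Prop :=
  [/\ s'.1 = s.1,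
      forall x : X, num s'.2 (inl x) = num s.2 (inl x) &
      exists e : top_switch Top, forall p : P,
        holds nil (before_after s.2 s'.2) (top_update e p)].

Variant state_change : Type :=
| Jump
| Flow of R & (R -> valuation)
| Update.

Definition is_change (c : state_change) (s s' : state) : Prop :=
  match c with
  | Jump => is_jump s s'
  | Flow t F => is_flow t F s s'
  | Update => is_update s s'
  end.

Definition is_Flow (c : state_change) : bool :=
  if c is Flow _ _ then true else false.

(* [run_length] is the number of state changes, [None] for an infinite run;
   change j leads from state j to state j.+1. *)
Record execution := Execution {
  run_length : option nat;
  run_state : nat -> state;
  run_change : nat -> state_change }.

Definition before_end (r : execution) (j : nat) : bool :=
  if run_length r is Some n then (j < n)%N else true.

Definition in_execution (r : execution) (j : nat) : bool :=
  if run_length r is Some n then (j <= n)%N else true.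

(* A finite run may end with a flow; otherwise the change after a flow is a
   jump or a topology update. *)
Definition is_run (r : execution) : Prop :=
  [/\ initial (run_state r 0),
      forall j, in_execution r j -> admissible (run_state r j),
      forall j, before_end r j ->
        is_change (run_change r j) (run_state r j) (run_state r j.+1) &
      forall j, before_end r j.+1 ->
        is_Flow (run_change r j) -> ~~ is_Flow (run_change r j.+1)].

Implicit Types phi : sentence R P (var X P).

Definition holds_during_flow phi (t : R) (F : R -> valuation) : Prop :=
  forall u : R, 0 <= u <= t -> holds nil (F u) phi.

Definition holds_throughout phi (r : execution) : Prop :=
  (forall j, in_execution r j -> holds nil (run_state r j).2 phi) /\
  (forall j t F, before_end r j -> run_change r j = Flow t F ->
     holds_during_flow phi t F).

Definition satisfies phi_entry phi_safe : Prop :=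
  forall r, is_run r -> holds nil (run_state r 0).2 phi_entry ->
    holds_throughout phi_safe r.

Definition preserved phi (s s' : state) : Prop :=
  holds nil s.2 phi -> holds nil s'.2 phi.

Definition preserved_flow phi (t : R) (F : R -> valuation) (s : state) : Prop :=
  holds nil s.2 phi -> holds_during_flow phi t F.

(* Global mode reachability. *)
Definition gmr phi_entry (s : state) : Prop :=
  exists a0 : valuation, holds nil a0 phi_entry /\
    exists t F, is_flow t F (s.1, a0) s.

Definition gmr_exhaustive phi_entry : Prop :=
  (forall s : state, holds nil s.2 phi_entry -> initial s) /\
  (forall s s' : state, gmr phi_entry s -> is_jump s s' \/ is_update s s' ->
     holds nil s'.2 phi_entry).

End SFHA.

(* Main.v *)
(** Along a run starting in [Phi_entry], every state either satisfies [Phi_entry]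
    or is the end of a flow starting in [Phi_entry]: flows are never consecutive,
    and GMR-exhaustiveness makes every jump or update out of such a state re-enter
    [Phi_entry].  Hence conditions (1) and (2) alone already yield safety.
    Conversely, a run of length 0, resp. a single flow, shows (1), resp. (2);
    (3) and (4) then follow from (1), as [Phi_entry] holds after every GMR jump
    or update. *)

Require Import Defs.
From HB Require Import structures.
From mathcomp Require Import all_boot all_order all_algebra.
From mathcomp Require Import all_classical all_reals all_analysis.

Local Open Scope classical_set_scope.
Local Open Scope ring_scope.

Import Order.TTheory GRing.Theory Num.Theory.
Import numFieldNormedType.Exports.

Section GlobalModeReachability.
Set Implicit Arguments.
Unset Strict Implicit.
Context {R : realType} {I : Type} (nil : I) {X P : finType} {S : sfha R X P}.
Local Notation state := (state I S).
Local Notation valuation := (interp R P (var X P) I).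
Implicit Types (s : state) (phi : sentence R P (var X P)) (r : execution I S).

Lemma initial_admissible s : initial nil s -> admissible nil s.
Proof. by move=> [[_ ?] hs]; split=> // i; case: (hs i). Qed.

Lemma is_flow_ge0 t (F : R -> valuation) s s' : is_flow nil t F s s' -> 0 <= t.
(* The sign of [t] is recorded only in the component flows; [nil] provides an index at which to read
   it. *)
Proof. by case=> _ _ /(_ nil) []. Qed.

Lemma is_flow_mode t (F : R -> valuation) s s' :
  is_flow nil t F s s' -> s'.1 = s.1.
Proof. by case=> _ _ h _; apply: funext => i; case: (h i). Qed.

(** The invariants are imposed on the closed interval from 0 to [t], hence at its right endpoint. *)
Lemma is_flow_admissible t (F : R -> valuation) s s' :
  is_flow nil t F s s' -> admissible nil s'.
Proof.
move=> hF; have t0 := is_flow_ge0 hF; case: hF => _ Ft hc hp.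
have tt : 0 <= t <= t by rewrite t0 lexx.
split=> [|i]; first by rewrite -Ft; case: (hp t tt).
by case: (hc i) => _ -> [_ <-] _ [/(_ t tt)].
Qed.

Lemma is_flow_refl s : admissible nil s -> is_flow nil 0 (fun=> s.2) s s.
Proof.
move=> [htop hinv]; split=> // i; split=> //.
- by move=> v; apply: continuous_subspaceT => u; exact: cvg_cst.
(* No time lies strictly between 0 and 0, so the differential condition is vacuous. *)
- split=> // u /andP[u0 /(lt_trans u0)].
  by rewrite ltxx.
Qed.

Lemma gmr_refl phi s : admissible nil s -> holds nil s.2 phi -> gmr nil phi s.
Proof.
move=> /is_flow_refl hs hphi; exists s.2; split=> //.
by exists 0, (fun=> s.2); rewrite -surjective_pairing.
Qed.

Lemma gmr_flow phi t (F : R -> valuation) s s' :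
  holds nil s.2 phi -> is_flow nil t F s s' -> gmr nil phi s'.
Proof.
move=> hphi hF; exists s.2; split=> //.
by exists t, F; rewrite (is_flow_mode hF) -surjective_pairing.
Qed.

Lemma in_executionS r j : in_execution r j.+1 = before_end r j.
Proof. by rewrite /in_execution /before_end; case: run_length. Qed.

Lemma before_end_in_execution r j : before_end r j -> in_execution r j.
Proof. by rewrite /before_end /in_execution; case: run_length => // n /ltnW. Qed.

(** Induction invariant along a run. The second case remembers that change [k] is a flow, so that
    alternation can forbid another flow from state [j]. *)
Definition entered phi r j : Prop :=
  holds nil (run_state r j).2 phi \/
  exists k t F, [/\ j = k.+1, run_change r k = Flow t F,
    holds nil (run_state r k).2 phi &
    is_flow nil t F (run_state r k) (run_state r j)].

Lemma run_entered phi r : gmr_exhaustive nil S phi -> is_run nil r ->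
  holds nil (run_state r 0).2 phi -> forall j, in_execution r j -> entered phi r j.
Proof.
move=> [hinit hexh] [_ _ hchange halt] h0; elim=> [_|j IH]; first by left.
rewrite in_executionS => hj.
have {}IH := IH (before_end_in_execution hj).
(* Exhaustiveness: a non-flow change out of a GMR state leads back into [phi]. *)
have leave : gmr nil phi (run_state r j) -> ~~ is_Flow (run_change r j) ->
    entered phi r j.+1.
  move=> hg; have := hchange j hj; case: run_change => //= h _; left.
  + by apply: hexh hg _; left.
  + by apply: hexh hg _; right.
case: IH => [hs|[k [t [F [jE ck hk hF]]]]].
- case cj: (run_change r j) (hchange j hj) => [|t F|] /= hc.
  + by apply: leave; [apply: gmr_refl => //; apply/initial_admissible/hinit | rewrite cj].
  + by right; exists j, t, F.
  + by apply: leave; [apply: gmr_refl => //; apply/initial_admissible/hinit | rewrite cj].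
- apply: leave; first exact: gmr_flow hk hF.
  by rewrite jE in hj *; apply: halt => //; rewrite ck.
Qed.

Lemma satisfies_entry phi psi : gmr_exhaustive nil S phi ->
  satisfies nil S phi psi ->
  forall s, holds nil s.2 phi -> holds nil s.2 psi.
Proof.
move=> [hinit _] hsat s hs.
(* A run of length 0 has no changes; [Jump] is a mere filler. *)
pose r := Execution (Some 0%N) (fun=> s) (fun=> Jump R I X P).
have hr : is_run nil r.
  by split=> //=; [exact: hinit | move=> *; exact/initial_admissible/hinit].
by have [+ _] := hsat r hr hs; exact: (fun h => h 0%N isT).
Qed.

Lemma satisfies_flow phi psi : gmr_exhaustive nil S phi ->
  satisfies nil S phi psi ->
  forall t F s s', holds nil s.2 phi -> is_flow nil t F s s' ->
  holds_during_flow nil psi t F.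
Proof.
move=> [hinit _] hsat t F s s' hs hF.
(* Only change 0 lies before the end, so the constant [Flow t F] does not violate alternation. *)
pose r := Execution (Some 1%N) (fun j => if j is 0%N then s else s')
  (fun=> Flow t F).
have hr : is_run nil r.
  split=> //=; first exact: hinit.
  - by case=> [_|j _]; [exact/initial_admissible/hinit | exact: is_flow_admissible hF].
  - by case.
by have [_ +] := hsat r hr hs; exact: (fun h => h 0%N t F isT erefl).
Qed.

Lemma satisfies_of_flow phi psi : gmr_exhaustive nil S phi ->
  (forall s, holds nil s.2 phi -> holds nil s.2 psi) ->
  (forall t F s s', holds nil s.2 phi -> is_flow nil t F s s' ->
     holds_during_flow nil psi t F) ->
  satisfies nil S phi psi.
Proof.
move=> hexh hentry hflow r hr h0; have hE := run_entered hexh hr h0.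
split=> [j hj|j t F hj cj].
- case: (hE j hj) => [/hentry //|[k [t [F [_ _ hk hF]]]]].
  (* State [j] is the value at time [t] of a flow from [phi], which is safe throughout. *)
  have [_ <- _ _] := hF.
  by apply: (hflow _ _ _ _ hk hF); rewrite (is_flow_ge0 hF) lexx.
- have [_ _ hchange halt] := hr.
  case: (hE j (before_end_in_execution hj)) => [hs|[k [t' [F' [jE ck _ _]]]]].
  + by have := hchange j hj; rewrite cj => /(hflow _ _ _ _ hs).
  (* Here a flow would directly follow the flow at [k]. *)
  + by move: (halt k); rewrite -jE ck cj => /(_ hj isT).
Qed.

End GlobalModeReachability.

Theorem theorem3p8 (R : realType)
    (I : Type) (hI : ([set: I] #= [set: nat])%card) (nil : I)
    (X P : finType) (PS PN : {set P}) (hP : (PS :|: PN)%SET = [set: P]%SET)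
    (S : sfha R X P)
    (m : nat) (phi_entry : formula R P (var X P) m 0)
    (phi_safe : sentence R P (var X P))
    (hentry : gmr_exhaustive nil S (forall_index phi_entry)) :
  let Phi_entry := forall_index phi_entry in
  satisfies nil S Phi_entry phi_safe <->
  [/\ (forall s : state I S, holds nil s.2 Phi_entry -> holds nil s.2 phi_safe),
      (forall (t : R) F (s s' : state I S), holds nil s.2 Phi_entry ->
         is_flow nil t F s s' -> preserved_flow nil phi_safe t F s),
      (forall s s' : state I S, gmr nil Phi_entry s -> is_jump s s' ->
         preserved nil phi_safe s s') &
      (forall s s' : state I S, gmr nil Phi_entry s -> is_update nil s s' ->
         preserved nil phi_safe s s')].
Proof.
move=> Phi_entry; split=> [hsat|[h1 h2 _ _]].
- have h1 := satisfies_entry hentry hsat.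
  split=> //.
  + by move=> t F s s' hs hF _; exact: satisfies_flow hentry hsat _ _ _ _ hs hF.
  + by move=> s s' hg hc _; apply/h1/(hentry.2 _ _ hg); left.
  + by move=> s s' hg hc _; apply/h1/(hentry.2 _ _ hg); right.
- apply: satisfies_of_flow => // t F s s' hs hF.
  (* (2) only preserves safety along the flow; (1) supplies it at the start. *)
  exact: h2 hs hF (h1 _ hs).
Qed.
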